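(* Let $\kappa$ be a positive integer and let $a,b$ be real numbers with $a,b,a+b\notin\{-1,-2,\dots\}$. For positive integers $N$ let $h_n^{a,b,N;\kappa}$ be the Krall Hahn polynomials defined in the context, where it is assumed that $R_\kappa^{-b,-a,a+b+N}(\theta_{-n}^{-a-b})\ne 0$ so that they are well-defined. Then for every integer $n\ge 0$ and every $x\in\mathbb{R}$, $$\lim_{N\to\infty}h_n^{a,b,N;\kappa}\!\left(\frac{(1-x)N}{2}\right)=\begin{cases}\dfrac{2n+a+b}{n+a+b}\,P_n^{a,b-1}(x), & \text{if } b\notin\{1,\dots,\kappa\},\\[6pt] P_n^{a,b;\infty}(x), & \text{if } b\in\{1,\dots,\kappa\},\end{cases}$$ where $P_n^{a,b;\infty}(x)=P_n^{a,b}(x)+\frac{n+b}{n}P_{n-1}^{a,b}(x)$ for $n\ge 1$ and $P_0^{a,b;\infty}=1$. (For $n=0$ the factor $\frac{2n+a+b}{n+a+b}$ is read as $1$.)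
   Context: $(y)_j=y(y+1)\cdots(y+j-1)$ is the Pochhammer symbol; binomials with real upper entry are generalized. Jacobi polynomials: $P_n^{\alpha,\beta}(x)=2^{-n}\sum_{j=0}^n\binom{n+\alpha}{j}\binom{n+\beta}{n-j}(x-1)^{n-j}(x+1)^j$. Hahn polynomials: for $N\ge n$ a positive integer, $h_n^{a,b,N}(x)=\frac{(a+1)_n}{n!}\,{}_3F_2\!\left(-n,-x,n+a+b+1;\,a+1,-N;\,1\right)=\frac1{n!}\sum_{j=0}^n\frac{(-n)_j(-x)_j(n+a+b+1)_j(a+j+1)_{n-j}}{(-N)_j\,j!}$. For real $w$: $\lambda_j^{w}(x)=\prod_{i=0}^{j-1}(x-i(w+i+1))$ and $\theta_x^{w}=x(x+w+1)$. Dual Hahn polynomials, for real parameters $A,B,M$: $R_n^{A,B,M}(x)=\sum_{j=0}^n\frac{(-n)_j(-M+j)_{n-j}(A+j+1)_{n-j}}{(-1)^j j!}\lambda_j^{A+B}(x)$. Krall Hahn polynomials: for positive integers $\kappa$, $N$, set $h_0^{a,b,N;\kappa}=1$ and for $1\le n\le N$ $$h_n^{a,b,N;\kappa}(x)=h_n^{a,b,N}(x)+\frac{(n+a)\,R_\kappa^{-b,-a,a+b+N}(\theta_{-n-1}^{-a-b})}{(n+a+b)\,R_\kappa^{-b,-a,a+b+N}(\theta_{-n}^{-a-b})}\,h_{n-1}^{a,b,N}(x).$$ (If $a>-1$ and $b>\kappa$ the denominators do not vanish and these polynomials are orthogonal with respect to $\sum_{x=0}^N (N+b-\kappa+1-x)_\kappa\binom{a+x}{x}\binom{N+b-\kappa-1-x}{N-x}\delta_x$.)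 *)

(* Defs.v *)
From HB Require Import structures.
From mathcomp Require Import all_boot all_order all_algebra.
From mathcomp Require Import all_classical all_reals all_analysis.

Set Implicit Arguments.
Unset Strict Implicit.
Unset Printing Implicit Defensive.

Import Order.TTheory GRing.Theory Num.Theory.
Import numFieldNormedType.Exports.

Local Open Scope classical_set_scope.
Local Open Scope ring_scope.

Definition poch (R : realType) (y : R) (j : nat) : R :=
  \prod_(i < j) (y + i%:R).

Definition gbinom (R : realType) (y : R) (j : nat) : R :=
  (\prod_(i < j) (y - i%:R)) / (j`!)%:R.

Definition jacobi (R : realType) (n : nat) (al be x : R) : R :=
  2 ^- n * \sum_(j < n.+1) gbinom (n%:R + al) j * gbinom (n%:R + be) (n - j)
                           * (x - 1) ^+ (n - j) * (x + 1) ^+ j.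

(* Meaningful for n <= N only: otherwise (-N)_j = 0 for N < j <= n, and
   the terms with such j are 0 since inverses of 0 are 0. *)
Definition hahn (R : realType) (n : nat) (a b : R) (N : nat) (x : R) : R :=
  (n`!)%:R^-1 *
  \sum_(j < n.+1)
    (poch (- n%:R) j * poch (- x) j * poch (n%:R + a + b + 1) j
       * poch (a + j%:R + 1) (n - j))
    / (poch (- N%:R) j * (j`!)%:R).

Definition lambda (R : realType) (w : R) (j : nat) (x : R) : R :=
  \prod_(i < j) (x - i%:R * (w + i%:R + 1)).

Definition theta (R : realType) (w x : R) : R := x * (x + w + 1).

Definition dual_hahn (R : realType) (n : nat) (A B M x : R) : R :=
  \sum_(j < n.+1)
    (poch (- n%:R) j * poch (- M + j%:R) (n - j) * poch (A + j%:R + 1) (n - j))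
    / ((-1) ^+ j * (j`!)%:R) * lambda (A + B) j x.

(* Meaningful for n <= N only. *)
Definition krall_hahn (R : realType) (n : nat) (a b : R) (N kappa : nat)
    (x : R) : R :=
  if n is n'.+1 then
    hahn n a b N x
    + ((n%:R + a)
         * dual_hahn kappa (- b) (- a) (a + b + N%:R)
             (theta (- a - b) (- n%:R - 1)))
      / ((n%:R + a + b)
         * dual_hahn kappa (- b) (- a) (a + b + N%:R)
             (theta (- a - b) (- n%:R)))
      * hahn n' a b N x
  else 1.

Definition jacobi_inf (R : realType) (n : nat) (a b x : R) : R :=
  if n is n'.+1 then
    jacobi n a b x + (n%:R + b) / n%:R * jacobi n' a b x
  else 1.

(* Main.v *)
Require Import Defs.
From HB Require Import structures.
From mathcomp Require Import all_boot all_order all_algebra.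
From mathcomp Require Import all_classical all_reals all_analysis.
From mathcomp Require Import ring zify.

(** As N grows, Hahn polynomials at (1-x)N/2 converge termwise to Jacobi
    polynomials in hypergeometric form.  Only the first nonvanishing term of the
    dual Hahn sum survives in the limit, because its j-th term has order
    N^(kappa-j) unless (1-b+j)_(kappa-j) = 0.  That first index is j = 0 when b
    is not in {1..kappa}, and then the quotient of dual Hahn values tends to 1
    and a contiguous relation for Jacobi polynomials concludes.  It is j = b
    otherwise, and then the quotient tends to the quotient of two values of
    lambda_b, where the factors telescope. *)

Import Order.TTheory GRing.Theory Num.Theory.
Import numFieldNormedType.Exports.
Local Open Scope classical_set_scope.
Local Open Scope ring_scope.

(** * Generalized binomials and Pochhammer symbols *)

Lemma gbinom0 (R : realType) (y : R) : gbinom y 0 = 1.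
Proof. by rewrite /gbinom big_ord0 fact0 divr1. Qed.

Lemma fact_natr_neq0 (R : realType) (n : nat) : n`!%:R != 0 :> R.
Proof. by rewrite pnatr_eq0 -lt0n fact_gt0. Qed.

Lemma gbinomS (R : realType) (y : R) (j : nat) :
  j.+1%:R * gbinom y j.+1 = (y - j%:R) * gbinom y j.
Proof.
rewrite /gbinom big_ord_recr /= factS natrM.
have h1 := fact_natr_neq0 R j.
have h2 : j.+1%:R != 0 :> R by rewrite pnatr_eq0.
by field; rewrite h1 addrC natr1 h2.
Qed.

Lemma gbinom_absorb (R : realType) (y : R) (j : nat) :
  j.+1%:R * gbinom y j.+1 = y * gbinom (y - 1) j.
Proof.
elim: j => [|j IHj]; first by rewrite gbinomS !gbinom0 subr0.
have nz : j.+1%:R != 0 :> R by rewrite pnatr_eq0.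
apply: (mulfI nz); rewrite gbinomS mulrCA IHj mulrCA [in RHS]mulrCA gbinomS.
by rewrite -natr1; ring.
Qed.

(** Both sides equal [j.+1%:R * gbinom (y + j%:R) j.+1]. *)
Lemma gbinom_contiguous (R : realType) (y : R) (j : nat) :
  (y + j%:R) * gbinom (y + j%:R - 1) j = y * gbinom (y + j%:R) j.
Proof. by rewrite -gbinom_absorb gbinomS addrK. Qed.

(** In the induction, the factor y + z - n is split as (y - j) + (z - (n - j)), and [gbinomS] lets
    each part raise one of the two lower indices. *)
Lemma gbinom_Vandermonde (R : realType) (y z : R) (n : nat) :
  gbinom (y + z) n = \sum_(j < n.+1) gbinom y j * gbinom z (n - j).
Proof.
elim: n => [|n IHn]; first by rewrite big_ord1 !gbinom0 mulr1.
have nz : n.+1%:R != 0 :> R by rewrite pnatr_eq0.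
apply: (mulfI nz); rewrite gbinomS IHn mulr_sumr.
transitivity (\sum_(j < n.+2) j%:R * gbinom y j * gbinom z (n.+1 - j)
  + \sum_(j < n.+2) gbinom y j * ((n.+1 - j)%:R * gbinom z (n.+1 - j))).
  rewrite (big_ord_recl n.+1) !mul0r add0r (big_ord_recr n.+1) /=.
  rewrite subnn mul0r mulr0 addr0 -big_split; apply: eq_bigr => -[j /= jn] _.
  by rewrite /bump /= add1n subSS subSn // !gbinomS natrB //; ring.
rewrite -big_split mulr_sumr; apply: eq_bigr => -[j /= jn] _.
by rewrite natrB //; ring.
Qed.

(** A falling factorial of length i + j splits into its first i factors and the other j. *)
Lemma gbinomD (R : realType) (y : R) (i j : nat) :
  gbinom y (i + j) * 'C(i + j, i)%:R = gbinom y i * gbinom (y - i%:R) j.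
Proof.
have h : ('C(i + j, i)%:R : R) = (i + j)`!%:R / (i`!%:R * j`!%:R).
  have := bin_fact (leq_addr j i); rewrite addKn => <-.
  by rewrite natrM natrM mulfK // mulf_neq0 // fact_natr_neq0.
rewrite {}h /gbinom big_split_ord /=.
under [X in _ * X / _]eq_bigr do rewrite natrD opprD addrA.
have h1 := fact_natr_neq0 R i.
have h2 := fact_natr_neq0 R j.
have h3 := fact_natr_neq0 R (i + j).
by field; rewrite h1 h2 h3.
Qed.

Lemma poch_gbinom (R : realType) (y : R) (j : nat) :
  poch (y + 1) j = j`!%:R * gbinom (y + j%:R) j.
Proof.
rewrite /gbinom mulrC divfK ?fact_natr_neq0 // /poch.
rewrite (reindex_inj rev_ord_inj); apply: eq_bigr => -[i /= ij] _.
by rewrite natrB // -natr1; ring.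
Qed.

Lemma poch_opp_nat (R : realType) (n j : nat) : (j <= n)%N ->
  poch (- n%:R : R) j * (n - j)`!%:R = (-1) ^+ j * n`!%:R.
Proof.
elim: j => [|j IHj] jn; first by rewrite /poch big_ord0 subn0 mul1r.
rewrite exprS -mulrA -IHj; last exact: ltnW.
rewrite /poch big_ord_recr /= -(subnSK jn) factS natrM (subnSK jn).
by rewrite natrB ?(ltnW jn) //; ring.
Qed.

(** * Jacobi polynomials in powers of (x - 1)/2 *)

(** These are the coefficients of the 2F1 form of the Jacobi polynomial; writing them with binomials
    avoids dividing by (al + 1)_k. *)
Definition jacobi_coef {R : realType} (n : nat) (al be : R) (k : nat) : R :=
  gbinom (n%:R + al) (n - k) * gbinom (n%:R + al + be + k%:R) k.

(** With t = (x - 1)/2 one has x + 1 = 2(t + 1). Once (t + 1)^j is expanded, the Vandermonde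
    identity sums the coefficient of each power of t. *)
Lemma jacobiE (R : realType) (n : nat) (al be x : R) :
  jacobi n al be x =
  \sum_(k < n.+1) jacobi_coef n al be k * ((x - 1) / 2) ^+ k.
Proof.
set t := (x - 1) / 2.
have x1 : x - 1 = 2 * t by rewrite /t; field.
have x2 : x + 1 = 2 * (t + 1) by rewrite /t; field.
clearbody t.
transitivity (\sum_(j < n.+1) \sum_(i < n.+1 | (i <= j)%N)
   gbinom (n%:R + al) j * gbinom (n%:R + be) (n - j) * 'C(j, i)%:R
   * t ^+ (n - i)).
  rewrite /jacobi mulr_sumr; apply: eq_bigr => -[j /= jn] _.
  rewrite x1 x2 !exprMn (exprDn t 1).
  have -> : 2 ^- n = 2 ^- (n - j) * 2 ^- j :> R.
    by rewrite -invfM -exprD subnK.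
  rewrite (big_ord_widen n.+1 (fun i => t ^+ (j - i) * 1 ^+ i *+ 'C(j, i))) //.
  have h : 2 != 0 :> R by [].
  transitivity (gbinom (n%:R + al) j * gbinom (n%:R + be) (n - j)
    * t ^+ (n - j) * \sum_(i < n.+1 | (i < j.+1)%N) t ^+ (j - i) * 1 ^+ i *+ 'C(j, i)).
    have h1 : 2 ^+ (n - j) != 0 :> R by rewrite expf_neq0.
    have h2 : 2 ^+ j != 0 :> R by rewrite expf_neq0.
    by field; rewrite h1 h2.
  rewrite mulr_sumr; apply: eq_bigr => -[i /= iN] ij.
  rewrite expr1n mulr1 -mulr_natr.
  have -> : (n - i = (n - j) + (j - i))%N by move: ij jn; lia.
  by rewrite exprD; ring.
(* Reversing the outer sum puts i = n - k, so that k is the exponent of t. *)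
rewrite (exchange_big_dep predT) //= (reindex_inj rev_ord_inj).
apply: eq_bigr => -[k /= kn] _.
rewrite subSS subKn // -mulr_suml; congr (_ * _).
rewrite /jacobi_coef.
(* The first summand is the upper entry that remains when [gbinomD] extracts
   [gbinom (n%:R + al) (n - k)]. *)
have -> : n%:R + al + be + k%:R = (n%:R + al - (n - k)%:R) + (n%:R + be) :> R.
  by rewrite natrB //; ring.
rewrite (gbinom_Vandermonde _ (n%:R + al - (n - k)%:R)) mulr_sumr.
rewrite -(big_mkord (fun j => (n - k <= j)%N) (fun j =>
  gbinom (n%:R + al) j * gbinom (n%:R + be) (n - j) * 'C(j, n - k)%:R)).
rewrite -(big_mkord predT (fun i => gbinom (n%:R + al) (n - k) *
   (gbinom (n%:R + al - (n - k)%:R) i * gbinom (n%:R + be) (k - i)))).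
(* The terms with j < n - k are excluded by the condition; the others are reindexed by j = i + (n -
   k). *)
rewrite (big_cat_nat (n := (n - k)%N)) //=; last by lia.
rewrite big_nat_cond big1 ?add0r; last by move=> i; lia.
rewrite -{1}(add0n (n - k)%N) big_addn.
have -> : (n.+1 - (n - k) = k.+1)%N by lia.
rewrite !big_mkord; apply: eq_big => [i|[i /= ik] _]; first by rewrite leq_addl.
rewrite (addnC i) mulrAC gbinomD -mulrA.
by congr (_ * (_ * gbinom _ _)); lia.
Qed.

(** The coefficients of each power of (x - 1)/2 agree: with S = n + 1 + al + be, the left factor is
    (S + k) + (n + 1 - k), and each summand yields one term on the right. *)
Lemma jacobi_contiguous (R : realType) (n : nat) (al be x : R) :
  (2 * n.+1%:R + al + be) * jacobi n.+1 al (be - 1) x =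
  (n.+1%:R + al + be) * jacobi n.+1 al be x
  + (n.+1%:R + al) * jacobi n al be x.
Proof.
rewrite !jacobiE !mulr_sumr.
(* Absorption raises the lower index n - k to n + 1 - k; the added term k = n + 1 is 0. *)
have -> : \sum_(k < n.+1) (n.+1%:R + al) *
    (jacobi_coef n al be k * ((x - 1) / 2) ^+ k) =
  \sum_(k < n.+2) ((n.+1 - k)%:R * gbinom (n.+1%:R + al) (n.+1 - k)
     * gbinom (n%:R + al + be + k%:R) k * ((x - 1) / 2) ^+ k).
  rewrite [RHS]big_ord_recr /= subnn !mul0r addr0.
  apply: eq_bigr => -[k /= kn] _; rewrite subSn // gbinom_absorb /jacobi_coef.
  have -> : n.+1%:R + al - 1 = n%:R + al by rewrite -natr1; ring.
  by rewrite !mulrA.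
rewrite -big_split; apply: eq_bigr => -[k /= kn] _.
rewrite !(mulrA _ (jacobi_coef _ _ _ _)) -mulrDl; congr (_ * _).
rewrite /jacobi_coef natrB //.
set S := n.+1%:R + al + be.
have -> : n.+1%:R + al + (be - 1) + k%:R = S + k%:R - 1 by rewrite /S; ring.
have -> : n%:R + al + be + k%:R = S + k%:R - 1 by rewrite /S -natr1; ring.
have -> : 2 * n.+1%:R + al + be = (S + k%:R) + (n.+1%:R - k%:R).
  by rewrite /S; ring.
rewrite mulrDl; congr (_ + _); last by rewrite mulrA.
by rewrite mulrCA gbinom_contiguous mulrCA mulrA.
Qed.

(** * Limits of products and quotients of affine functions of N *)

Lemma cvg_affine_div (R : realType) (r s : R) :
  (fun N : nat => (r * N%:R + s) / N%:R) @ \oo --> r.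
Proof.
(* The shift avoids N = 0, where the quotient has its default value 0. *)
rewrite -cvg_shiftS /=.
rewrite [X in X @ \oo](_ : _ = (fun N : nat => r + s * harmonic N)); last first.
  by apply/funext => N; rewrite /= mulrDl mulfK // pnatr_eq0.
have : (fun N : nat => r + s * harmonic N) @ \oo --> r + s * 0.
  by apply: cvgD; [exact: cvg_cst | apply: cvgMr; exact: cvg_harmonic].
by rewrite mulr0 addr0.
Qed.

Lemma cvg_prodr (R : realType) (n : nat) (f : 'I_n -> nat -> R) (l : 'I_n -> R) :
  (forall i, f i @ \oo --> l i) ->
  (fun N => \prod_(i < n) f i N) @ \oo --> \prod_(i < n) l i.
Proof.
move=> fl; apply: (@cvg_big R _ *%R 1 xpredT); first exact: mul_continuous.
by move=> i _; exact: fl.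
Qed.

Lemma cvg_sumr (R : realType) (n : nat) (f : 'I_n -> nat -> R) (l : 'I_n -> R) :
  (forall i, f i @ \oo --> l i) ->
  (fun N => \sum_(i < n) f i N) @ \oo --> \sum_(i < n) l i.
Proof.
move=> fl; apply: (@cvg_big R _ +%R 0 xpredT); first exact: add_continuous.
by move=> i _; exact: fl.
Qed.

Lemma cvg_poch_affine (R : realType) (r s : R) (j : nat) :
  (fun N : nat => poch (r * N%:R + s) j / N%:R ^+ j) @ \oo --> r ^+ j.
Proof.
have pj (y : R) : y ^+ j = \prod_(i < j) y by rewrite prodr_const card_ord.
have -> : (fun N : nat => poch (r * N%:R + s) j / N%:R ^+ j) =
    (fun N : nat => \prod_(i < j) ((r * N%:R + (s + i%:R)) / N%:R)).
  apply/funext => N; rewrite /poch pj -prodfV.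
  by rewrite -big_split; apply: eq_bigr => i _; rewrite addrA.
by rewrite pj; apply: cvg_prodr => i; exact: cvg_affine_div.
Qed.

Lemma cvg_div_leading (R : realType) (k : nat) (f g : nat -> R) (l m : R) :
  m != 0 ->
  (fun N : nat => f N / N%:R ^+ k) @ \oo --> l ->
  (fun N : nat => g N / N%:R ^+ k) @ \oo --> m ->
  (fun N : nat => f N / g N) @ \oo --> l / m.
Proof.
move=> m0 fl gm; apply: cvg_trans (cvgM fl (cvgV m0 gm)).
apply: near_eq_cvg; exists 1%N => // N /= N0.
have Nk0 : N%:R ^+ k != 0 :> R by rewrite expf_neq0 // pnatr_eq0 -lt0n.
by rewrite /= invfM invrK mulrACA mulVf // mulr1.
Qed.

(** * Limits of Hahn and dual Hahn polynomials *)

(** In the j-th term only a quotient of two products of j affine factors depends on N, and it tends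
    to ((x - 1)/2)^j / (-1)^j. *)
Lemma hahn_cvg (R : realType) (n : nat) (a b x : R) :
  (fun N : nat => hahn n a b N ((1 - x) * N%:R / 2)) @ \oo --> jacobi n a b x.
Proof.
pose c (j : nat) : R := poch (- n%:R) j * poch (n%:R + a + b + 1) j *
    poch (a + j%:R + 1) (n - j) / j`!%:R.
have -> : jacobi n a b x =
    n`!%:R^-1 * \sum_(j < n.+1) c j * (((x - 1) / 2) ^+ j / (-1) ^+ j).
  rewrite jacobiE mulr_sumr; apply: eq_bigr => -[j /= jn] _.
  rewrite /c /jacobi_coef !poch_gbinom.
  have := poch_opp_nat R n j jn.
  have -> : n%:R + a = a + j%:R + (n - j)%:R :> R by rewrite natrB //; ring.
  move: (gbinom _ (n - j)) (gbinom _ j) => g1 g2 h.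
  have h1 := fact_natr_neq0 R j.
  have h2 := fact_natr_neq0 R n.
  have h3 := fact_natr_neq0 R (n - j).
  have -> : poch (- n%:R) j = (-1) ^+ j * n`!%:R / (n - j)`!%:R :> R.
    by rewrite -h mulfK.
  have h4 : (-1) ^+ j != 0 :> R by rewrite signr_eq0.
  by field; rewrite h1 h2 h3 h4.
apply: cvgMr; apply: cvg_sumr => -[j /= jn].
have -> : (fun N : nat => poch (- n%:R) j * poch (- ((1 - x) * N%:R / 2)) j *
      poch (n%:R + a + b + 1) j * poch (a + j%:R + 1) (n - j) /
      (poch (- N%:R) j * j`!%:R)) =
    (fun N : nat => c j * (poch ((x - 1) / 2 * N%:R + 0) j /
                           poch (- 1 * N%:R + 0) j)).
  apply/funext => N; rewrite /c !addr0 mulN1r invfM.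
  have -> : - ((1 - x) * N%:R / 2) = (x - 1) / 2 * N%:R by field.
  by ring.
apply: cvgMr; apply: cvg_div_leading; first by rewrite signr_eq0.
  exact: cvg_poch_affine.
exact: cvg_poch_affine.
Qed.

(** Terms below [j0] vanish by hypothesis, those above it have degree less than k - j0 in N, and the
    term [j0] contributes its leading coefficient. *)
Lemma dual_hahn_cvg (R : realType) (k j0 : nat) (A B c x : R) :
  (j0 <= k)%N ->
  (forall j, (j < j0)%N -> poch (A + j%:R + 1) (k - j) = 0) ->
  (fun N : nat => dual_hahn k A B (c + N%:R) x / N%:R ^+ (k - j0)) @ \oo -->
  poch (- k%:R) j0 * (-1) ^+ (k - j0) * poch (A + j0%:R + 1) (k - j0)
    / ((-1) ^+ j0 * j0`!%:R) * lambda (A + B) j0 x.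
Proof.
move=> j0k hA.
pose d (j : nat) : R := poch (- k%:R) j * poch (A + j%:R + 1) (k - j)
  / ((-1) ^+ j * j`!%:R) * lambda (A + B) j x.
have -> : poch (- k%:R) j0 * (-1) ^+ (k - j0) * poch (A + j0%:R + 1) (k - j0)
    / ((-1) ^+ j0 * j0`!%:R) * lambda (A + B) j0 x =
   \sum_(j < k.+1) d j * (if j == j0 :> nat then (-1) ^+ (k - j0) else 0).
  rewrite (bigD1 (Ordinal (j0k : (j0 < k.+1)%N))) //= eqxx big1 ?addr0.
    by rewrite /d; ring.
  move=> j; rewrite -val_eqE /= => /negPf ->; exact: mulr0.
have -> : (fun N : nat => dual_hahn k A B (c + N%:R) x / N%:R ^+ (k - j0)) =
  (fun N : nat => \sum_(j < k.+1)
     d j * (poch (- 1 * N%:R + (j%:R - c)) (k - j) / N%:R ^+ (k - j0))).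
  apply/funext => N; rewrite /dual_hahn mulr_suml; apply: eq_bigr => j _.
  have -> : - 1 * N%:R + (j%:R - c) = - (c + N%:R) + j%:R by ring.
  by rewrite /d; ring.
apply: cvg_sumr => -[j /= jk].
have [jj0|] := ltnP j j0.
  rewrite /d hA // mulr0 !mul0r.
  by under [X in X @ \oo]eq_fun do rewrite !mul0r; exact: cvg_cst.
rewrite leq_eqVlt => /predU1P[->|jj0].
  by rewrite eqxx; apply: cvgMr; exact: cvg_poch_affine.
rewrite gtn_eqF //; apply: cvgMr.
(* The surplus power of 1/N is written as a power of an affine quotient of slope 0, hence of limit
   0. *)
have -> : (fun N : nat => poch (- 1 * N%:R + (j%:R - c)) (k - j)
                          / N%:R ^+ (k - j0))
  = (fun N : nat => poch (- 1 * N%:R + (j%:R - c)) (k - j) / N%:R ^+ (k - j)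
                    * ((0 * N%:R + 1) / N%:R) ^+ (j - j0)).
  apply/funext => N; rewrite mul0r add0r div1r exprVn -mulrA -invfM -exprD.
  by congr (_ / _ ^+ _); lia.
suff : (fun N : nat => poch (- 1 * N%:R + (j%:R - c)) (k - j) / N%:R ^+ (k - j)
      * ((0 * N%:R + 1) / N%:R) ^+ (j - j0))
    @ \oo --> ((-1) ^+ (k - j) * 0 ^+ (j - j0) : R).
  by rewrite [0 ^+ _]expr0n subn_eq0 leqNgt jj0 mulr0.
apply: cvgM; first exact: cvg_poch_affine.
apply: (@cvg_comp _ _ _ _ (fun y : R => y ^+ (j - j0))).
  exact: cvg_affine_div.
exact: exprn_continuous.
Qed.

Lemma dual_hahn_ratio_cvg (R : realType) (k j0 : nat) (A B c x y : R) :
  (j0 <= k)%N ->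
  (forall j, (j < j0)%N -> poch (A + j%:R + 1) (k - j) = 0) ->
  poch (A + j0%:R + 1) (k - j0) != 0 -> lambda (A + B) j0 y != 0 ->
  (fun N : nat => dual_hahn k A B (c + N%:R) x / dual_hahn k A B (c + N%:R) y)
    @ \oo --> lambda (A + B) j0 x / lambda (A + B) j0 y.
Proof.
move=> j0k hA hA0 hy.
have pk : poch (- k%:R) j0 != 0 :> R.
  have := poch_opp_nat R k j0 j0k; apply: contra_eq_neq => ->.
  by rewrite mul0r eq_sym mulf_neq0 ?signr_eq0 ?fact_natr_neq0.
have s1 : (-1) ^+ (k - j0) != 0 :> R by rewrite signr_eq0.
have s2 : (-1) ^+ j0 != 0 :> R by rewrite signr_eq0.
have f0 := fact_natr_neq0 R j0.
(* [e] gathers what the two limits share; it is nonzero and cancels in the ratio. *)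
pose e : R := poch (- k%:R) j0 * (-1) ^+ (k - j0) * poch (A + j0%:R + 1) (k - j0)
    / ((-1) ^+ j0 * j0`!%:R).
have e0 : e != 0 by rewrite /e !mulf_neq0 ?invr_eq0 ?mulf_neq0.
have -> : lambda (A + B) j0 x / lambda (A + B) j0 y
  = (e * lambda (A + B) j0 x) / (e * lambda (A + B) j0 y).
  by rewrite invfM mulrACA mulfV // mul1r.
apply: cvg_div_leading; first by rewrite mulf_neq0.
  exact: dual_hahn_cvg.
exact: dual_hahn_cvg.
Qed.

(** * Factorization of [lambda] at [theta] *)

Lemma lambda_theta (R : realType) (w y : R) (j : nat) :
  lambda w j (theta w y) = \prod_(i < j) ((y - i%:R) * (y + i%:R + w + 1)).
Proof. by apply: eq_bigr => i _; rewrite /theta; ring. Qed.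

(** Passing from y to y - 1 shifts both families of linear factors by one, so all but the end
    factors cancel; the cross-multiplied form needs no nonvanishing condition. *)
Lemma lambda_theta_pred (R : realType) (w y : R) (j : nat) :
  lambda w j (theta w (y - 1)) * (y * (y + w + j%:R)) =
  lambda w j (theta w y) * ((y - j%:R) * (y + w)).
Proof.
rewrite !lambda_theta; elim: j => [|j]; first by rewrite !big_ord0; ring.
rewrite !(big_ord_recr j) /= -natr1.
set u := \prod_(i < j) _; set v := \prod_(i < j) _ => uv.
transitivity (u * (y * (y + w + j%:R))
  * ((y - j%:R - 1) * (y + w + j%:R + 1))); first by ring.
by rewrite uv; ring.
Qed.

(** * The limit of Krall Hahn polynomials *)

Theorem lemma3p1 (R : realType) (kappa : nat) (a b : R)
  (kappa_gt0 : (0 < kappa)%N)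
  (a_notnegint : forall m : nat, a <> - m.+1%:R)
  (b_notnegint : forall m : nat, b <> - m.+1%:R)
  (ab_notnegint : forall m : nat, a + b <> - m.+1%:R)
  (dual_hahn_neq0 : forall N n : nat, (1 <= n <= N)%N ->
     dual_hahn kappa (- b) (- a) (a + b + N%:R) (theta (- a - b) (- n%:R)) <> 0)
  (n : nat) (x : R) :
  (fun N : nat => krall_hahn n a b N kappa ((1 - x) * N%:R / 2)) @ \oo -->
    (if b \in [seq m%:R | m <- iota 1 kappa] then jacobi_inf n a b x
     else (if n == 0%N then 1 else (2 * n%:R + a + b) / (n%:R + a + b))
          * jacobi n a (b - 1) x).
Proof.
case: n => [|n].
  have -> : jacobi 0 a (b - 1) x = 1 :> R.
    by rewrite /jacobi big_ord1 !gbinom0 !expr0 invr1 !mulr1.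
  by rewrite /= mulr1 if_same; exact: cvg_cst.
have an_neq0 i : n.+1%:R + a + i%:R != 0.
  apply/eqP => h; apply: (a_notnegint (n + i)%N).
  by rewrite -addSn natrD -[RHS]addr0 -h; ring.
have abn_neq0 : n.+1%:R + a + b != 0.
  apply/eqP => h; apply: (ab_notnegint n).
  by rewrite -[RHS]addr0 -h; ring.
rewrite /krall_hahn /jacobi_inf.
pose w := - a - b; have wE : - b + - a = w by rewrite addrC.
pose L j y : R := lambda w j (theta w y).
pose S := [seq m%:R | m <- iota 1 kappa] : seq R.
(* [j0] indexes the dominant dual Hahn term; the last clause evaluates the limit of the coefficient
   of the lower Hahn polynomial. *)
have [j0 [j0k hA hA0 hL hl]] : exists j0 : nat, [/\ (j0 <= kappa)%N,
    forall j, (j < j0)%N -> poch (- b + j%:R + 1) (kappa - j) = 0,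
    poch (- b + j0%:R + 1) (kappa - j0) != 0, L j0 (- n.+1%:R) != 0 &
    (n.+1%:R + a) / (n.+1%:R + a + b) *
      (L j0 (- n.+1%:R - 1) / L j0 (- n.+1%:R))
    = if b \in S then (n.+1%:R + b) / n.+1%:R
      else (n.+1%:R + a) / (n.+1%:R + a + b) ].
  have [/mapP[j0 + bj0]|bS] := boolP (b \in S).
    rewrite mem_iota add1n ltnS => /andP[j0_gt0 j0k].
    have hL0 : L j0 (- n.+1%:R) != 0.
      rewrite /L lambda_theta; apply/prodf_neq0 => i _; rewrite mulf_neq0 //.
      have -> : - n.+1%:R + i%:R + w + 1 = - (n.+1%:R + a + (j0 - i.+1)%:R).
        by rewrite /w bj0 natrB // -natr1; ring.
      by rewrite oppr_eq0.
    exists j0; split => //.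
    - move=> j jj0; rewrite /poch.
      (* For j < b, the factor of index b - j - 1 in (1 - b + j)_(kappa - j) is 0, and b <= kappa
         keeps this index in range. *)
      have ltk : (j0 - j.+1 < kappa - j)%N by lia.
      rewrite (bigD1 (Ordinal ltk)) //= bj0 natrB // -natr1.
      by apply/eqP; rewrite mulf_eq0; apply/orP; left; apply/eqP; ring.
    - rewrite bj0 addNr add0r; apply/prodf_neq0 => i _.
      by rewrite addrC natr1 pnatr_eq0.
    - have m0 : n.+1%:R != 0 :> R by rewrite pnatr_eq0.
      have ma0 := an_neq0 0%N; rewrite addr0 in ma0.
      have LSb := lambda_theta_pred R w (- n.+1%:R) j0.
      move: hL0 abn_neq0 m0 ma0 LSb; rewrite -bj0 -!/(L _ _) /w.
      move: (L j0 (- n.+1%:R)) (L j0 (- n.+1%:R - 1)) => u v.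
      move: (n.+1%:R : R) => m u0 abm0 m0 ma0 uv.
      (* This is [lambda_theta_pred] at y = -m with w = -a - b and [j0] = b; the prefactor then
         leaves (m + b)/m. *)
      have -> : v = u * ((m + b) * (m + a + b)) / (m * (m + a)).
        apply: (canRL (mulfK _)); first by rewrite mulf_neq0.
        transitivity (v * (- m * (- m + (- a - b) + b))); first by ring.
        by rewrite uv; ring.
      by field; rewrite u0 abm0 m0 ma0.
  (* Here no factor i + 1 - b of (1 - b)_kappa vanishes, and [lambda] of index 0 is 1. *)
  exists 0%N; split => //.
  - rewrite subn0 addr0; apply/prodf_neq0 => -[i /= ik] _.
    apply: contraNneq bS => h; apply/mapP; exists i.+1.
      by rewrite mem_iota add1n ltnS.
    by apply/eqP; rewrite eq_sym -subr_eq0 -h -natr1; apply/eqP; ring.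
  - by rewrite /L lambda_theta big_ord0 oner_neq0.
  - by rewrite /L !lambda_theta !big_ord0 divr1 mulr1.
have ratio : (fun N : nat =>
    dual_hahn kappa (- b) (- a) (a + b + N%:R) (theta w (- n.+1%:R - 1)) /
    dual_hahn kappa (- b) (- a) (a + b + N%:R) (theta w (- n.+1%:R)))
    @ \oo --> L j0 (- n.+1%:R - 1) / L j0 (- n.+1%:R).
  by rewrite /L -wE; apply: dual_hahn_ratio_cvg => //; rewrite wE.
rewrite -/S; set l := (X in _ --> X).
(* For b in [S] this is the definition of [jacobi_inf]; otherwise it is the contiguous relation
   divided by n + 1 + a + b. *)
have -> : l = jacobi n.+1 a b x + (n.+1%:R + a) / (n.+1%:R + a + b) *
   (L j0 (- n.+1%:R - 1) / L j0 (- n.+1%:R)) * jacobi n a b x.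
  rewrite hl /l; case: ifP => // _; apply: (mulfI abn_neq0).
  rewrite mulrA [X in X * _ = _]mulrC divfK // jacobi_contiguous.
  move: abn_neq0 (jacobi n.+1 a b x) (jacobi n a b x).
  by move: (n.+1%:R : R) => m m0 u v; field.
rewrite [X in X @ \oo](_ : _ = (fun N : nat =>
    hahn n.+1 a b N ((1 - x) * N%:R / 2) +
    (n.+1%:R + a) / (n.+1%:R + a + b) *
    (dual_hahn kappa (- b) (- a) (a + b + N%:R) (theta w (- n.+1%:R - 1)) /
     dual_hahn kappa (- b) (- a) (a + b + N%:R) (theta w (- n.+1%:R)))
    * hahn n a b N ((1 - x) * N%:R / 2))); last first.
  by apply/funext => N; congr (_ + _ * _); rewrite invfM mulrACA.
apply: cvgD; first exact: hahn_cvg.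
by apply: cvgM; [apply: cvgMr; exact: ratio | exact: hahn_cvg].
Qed.
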